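(* Given a set $\mathcal{R}$ of rules on a finite set $Q$ and a subset $X\subseteq Q$, the maximum member $X^\circ$ of $\mathcal{A}(\mathcal{R})$ contained in $X$ can be computed in linear time, i.e. in time $O(l(\mathcal{R}))$.
   Context: A rule on $Q$ is a pair $(A,q)$ with $A\subseteq Q$, $q\in Q$; it accepts $Y\subseteq Q$ if $q\in Y$ implies $Y\cap A\neq\emptyset$. $\mathcal{K}(\mathcal{R})$ is the family of subsets accepted by all rules of $\mathcal{R}$, and $\mathcal{A}(\mathcal{R})$ is the family of $K\in\mathcal{K}(\mathcal{R})$ for which there is a sequence $\emptyset=Y_0\subseteq\dots\subseteq Y_k=K$ of members of $\mathcal{K}(\mathcal{R})$ with $|Y_{i+1}\setminus Y_i|=1$. $\mathcal{A}(\mathcal{R})$ is union-closed and contains $\emptyset$, so for each $X\subseteq Q$ there is a unique maximal member $X^\circ$ of $\mathcal{A}(\mathcal{R})$ contained in $X$. The input size is $l(\mathcal{R})=\sum_{(A,q)\in\mathcal{R}}(|A|+1)$, assumed to satisfy $l(\mathcal{R})\ge|Q|$. *)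

(* Defs.v *)
From mathcomp Require Import all_boot.
Set Implicit Arguments. Unset Strict Implicit. Unset Printing Implicit Defensive.

Section Rules.
Variable T : finType.

Local Notation rule := ({set T} * T)%type.

Definition accepts (r : rule) (Y : {set T}) : bool :=
  (r.2 \in Y) ==> (Y :&: r.1 != set0).

Definition inK (R : seq rule) (Y : {set T}) : bool := all (fun r => accepts r Y) R.

Definition inA (R : seq rule) (K : {set T}) : Prop :=
  exists Ys : seq {set T},
    [/\ path (fun Y Y' : {set T} => (Y \subset Y') && (#|Y' :\: Y| == 1)) set0 Ys,
        last set0 Ys = K &
        all (inK R) (set0 :: Ys)].

Definition is_interior (R : seq rule) (X Y : {set T}) : Prop :=
  [/\ inA R Y, Y \subset X &
      forall Z, inA R Z -> Z \subset X -> Z \subset Y].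

Definition lsize (R : seq rule) : nat := \sum_(r <- R) (#|r.1| + 1).
End Rules.
Notation rule T := ({set T} * T)%type.

(* ---------- Model of computation: unit-cost RAM ----------
   Registers and memory are both nat -> nat (unbounded natural numbers).
   Every executed instruction costs one step. *)
Inductive instr : Type :=
| IConst of nat & nat
| IAdd of nat & nat & nat
| ISub of nat & nat & nat    (* ISub r a b   : reg r := reg a - reg b (trunc) *)
| ILoad of nat & nat
| IStore of nat & nat
| IJz of nat & nat
| IHalt.

Record config := Config { pc : nat; regs : nat -> nat; mem : nat -> nat }.

Definition upd (f : nat -> nat) (i v : nat) : nat -> nat :=
  fun j => if j == i then v else f j.

(* One step; None means the machine has halted (IHalt or pc out of range). *)
Definition step (P : seq instr) (c : config) : option config :=
  let: Config p g m := c in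
  match nth IHalt P p with
  | IConst r v => Some (Config p.+1 (upd g r v) m)
  | IAdd r a b => Some (Config p.+1 (upd g r (g a + g b)) m)
  | ISub r a b => Some (Config p.+1 (upd g r (g a - g b)) m)
  | ILoad r a => Some (Config p.+1 (upd g r (m (g a))) m)
  | IStore a b => Some (Config p.+1 g (upd m (g a) (g b)))
  | IJz a t => Some (Config (if g a == 0 then t else p.+1) g m)
  | IHalt => None
  end.

Fixpoint run (P : seq instr) (k : nat) (c : config) : option (nat -> nat) :=
  match step P c with
  | None => Some (mem c)
  | Some c' => if k is k'.+1 then run P k' c' else None
  end.

Definition encode n (R : seq (rule 'I_n)) (X : {set 'I_n}) : seq nat :=
  [:: n; size R] ++ [seq nat_of_bool (i \in X) | i <- enum 'I_n] ++
  flatten [seq (nat_of_ord r.2) :: #|r.1| :: [seq nat_of_ord a | a <- enum r.1]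
          | r : {set 'I_n} * 'I_n <- R].

Definition init_config (inp : seq nat) : config :=
  Config 0 (fun _ => 0) (fun i => nth 0 inp i).

Definition decode n (m : nat -> nat) : {set 'I_n} := [set i : 'I_n | m i != 0].

(* Main.v *)
Require Import Defs.
From mathcomp Require Import all_boot zify.
Set Implicit Arguments. Unset Strict Implicit. Unset Printing Implicit Defensive.

(* An element q can be appended to Y exactly when every rule (A, q) has q in A
   or A meeting Y, so the interior is reached greedily.  For each q keep the
   number of rules (A, q) not yet satisfied, plus one if q is not in X; an
   element is queued when its counter reaches zero.  Taking a off the queue
   visits the rules (A, q) with a in A through a linked list, and the first
   visit to a rule decrements the counter of q.  Every occurrence of an element
   in a rule is visited at most once.
   The algorithm is written in a small language with loops and eight arrays,
   compiled to the RAM; the running time is bounded by the number of loop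
   iterations times the size of the code. *)

(** * A loop language with arrays on the RAM *)

Lemma run_mono P k k' c m : run P k c = Some m -> k <= k' -> run P k' c = Some m.
Proof.
elim: k k' c => [|k IH] [|k'] c //=; case: (step P c) => // c'; exact: IH.
Qed.

Definition halts_in (P : seq instr) (Post : (nat -> nat) -> Prop) k c :=
  exists m, run P k c = Some m /\ Post m.

Lemma halts_in_mono P Post k k' c :
  halts_in P Post k c -> k <= k' -> halts_in P Post k' c.
Proof. by move=> [m [rc pm]] le_k; exists m; split=> //; apply: run_mono le_k. Qed.

Lemma halts_in_step P Post k k' c c' :
  step P c = Some c' -> halts_in P Post k c' -> k < k' -> halts_in P Post k' c.
Proof.
move=> sc [m [rc pm]] lt_k; exists m; split=> //; apply: run_mono lt_k.
by rewrite /= sc.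
Qed.

Inductive cmd : Type :=
| CConst of nat & nat
| CAdd of nat & nat & nat
| CSub of nat & nat & nat
| CLoad of nat & nat & nat
| CStore of nat & nat & nat
| CSeq of cmd & cmd
| CWhile of nat & cmd.

Declare Scope cmd_scope.
Delimit Scope cmd_scope with cmd.
Notation "c1 ;; c2" := (CSeq c1 c2) (at level 61, right associativity) : cmd_scope.

Fixpoint csize (c : cmd) : nat :=
  match c with
  | CConst _ _ | CAdd _ _ _ | CSub _ _ _ => 1
  | CLoad _ _ _ | CStore _ _ _ => 2
  | CSeq c1 c2 => csize c1 + csize c2
  | CWhile _ c1 => csize c1 + 2
  end.

(* Machine registers 0-7 hold the base addresses of the eight arrays (so
   register 0 always holds 0), 8 is scratch, and variable [r] lives in
   register [r + 9]. *)
Fixpoint compile (o : nat) (c : cmd) : seq instr :=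
  match c with
  | CConst r v => [:: IConst (r + 9) v]
  | CAdd r a b => [:: IAdd (r + 9) (a + 9) (b + 9)]
  | CSub r a b => [:: ISub (r + 9) (a + 9) (b + 9)]
  | CLoad r f a => [:: IAdd 8 f (a + 9); ILoad (r + 9) 8]
  | CStore f a b => [:: IAdd 8 f (a + 9); IStore 8 (b + 9)]
  | CSeq c1 c2 => compile o c1 ++ compile (o + csize c1) c2
  | CWhile r c1 => IJz (r + 9) (o + csize c1 + 2) :: compile o.+1 c1 ++ [:: IJz 0 o]
  end.

Lemma size_compile c o : size (compile o c) = csize c.
Proof.
elim: c o => //= [c1 IH1 c2 IH2|r c1 IH1] o; first by rewrite size_cat IH1 IH2.
by rewrite size_cat IH1 /= addn2 addn1.
Qed.

Definition upd2 (M : nat -> nat -> nat) f x v : nat -> nat -> nat :=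
  fun f' => if f' == f then upd (M f) x v else M f'.

(* Weakest precondition with credits: [k] bounds the number of loop iterations
   still allowed, so only [CWhile] consumes credits; [B] is the common length of
   the arrays. *)
Fixpoint wp (B : nat) (c : cmd)
    (Q : nat -> (nat -> nat) -> (nat -> nat -> nat) -> Prop)
    (k : nat) (h : nat -> nat) (M : nat -> nat -> nat) : Prop :=
  match c with
  | CConst r v => Q k (upd h r v) M
  | CAdd r a b => Q k (upd h r (h a + h b)) M
  | CSub r a b => Q k (upd h r (h a - h b)) M
  | CLoad r f a => (f < 8) && (h a < B) /\ Q k (upd h r (M f (h a))) M
  | CStore f a b => (f < 8) && (h a < B) /\ Q k h (upd2 M f (h a) (h b))
  | CSeq c1 c2 => wp B c1 (wp B c2 Q) k h M
  | CWhile r c1 => exists I : nat -> (nat -> nat) -> (nat -> nat -> nat) -> Prop,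
      I k h M /\
      forall k' h' M', I k' h' M' ->
        if h' r == 0 then Q k' h' M' else 0 < k' /\ wp B c1 I k'.-1 h' M'
  end.

Definition code_at (P : seq instr) o l :=
  forall i, i < size l -> nth IHalt P (o + i) = nth IHalt l i.

Lemma code_at_catl P o l1 l2 : code_at P o (l1 ++ l2) -> code_at P o l1.
Proof.
move=> H i Hi; rewrite H ?nth_cat ?Hi // size_cat; exact: ltn_addr.
Qed.

Lemma code_at_catr P o l1 l2 :
  code_at P o (l1 ++ l2) -> code_at P (o + size l1) l2.
Proof.
move=> H i Hi; rewrite -addnA H ?size_cat ?ltn_add2l // nth_cat.
by rewrite ltnNge leq_addr /= addKn.
Qed.

Lemma code_at_cons P o a l :
  code_at P o (a :: l) -> nth IHalt P o = a /\ code_at P o.+1 l.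
Proof.
move=> H; split; first by have := H 0; rewrite addn0 => ->.
by move=> i Hi; rewrite addSnnS H.
Qed.

(** Since array 0 starts at address 0, the input is read and the result written in place, without
    copying. *)
Definition rep B (h : nat -> nat) (M : nat -> nat -> nat) (g m : nat -> nat) :=
  [/\ forall f, f < 8 -> g f = f * B,
      forall r, g (r + 9) = h r
    & forall f x, f < 8 -> x < B -> m (f * B + x) = M f x].

Lemma rep_reg B h M g m r v : rep B h M g m -> rep B (upd h r v) M (upd g (r + 9) v) m.
Proof.
move=> [H1 H2 H3]; split=> // [f Hf|r']; rewrite /upd.
  by case: eqP => [?|_]; [lia | exact: H1].
by rewrite eqn_add2r H2.
Qed.

Lemma rep_scratch B h M g m v : rep B h M g m -> rep B h M (upd g 8 v) m.
Proof.
move=> [H1 H2 H3]; split=> // [f Hf|r']; rewrite /upd; case: eqP => [?|_]; try lia.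
  exact: H1.
exact: H2.
Qed.

Lemma rep_mem B h M g m f x v : f < 8 -> x < B ->
  rep B h M g m -> rep B h (upd2 M f x v) g (upd m (f * B + x) v).
Proof.
move=> Hf Hx [H1 H2 H3]; split=> // f' x' Hf' Hx'; rewrite /upd2 /upd.
case: (f' =P f) => [->|ne]; first by rewrite eqn_add2l; case: eqP => // _; exact: H3.
case: eqP => [E|_]; last exact: H3.
(* Division by [B] recovers the array number from an address, so distinct arrays do not overlap. *)
by case: ne; move: (congr1 (divn^~ B) E); rewrite !divnMDl ?divn_small ?addn0; lia.
Qed.

(** Stated with a continuation that needs [e] further steps from the end of the code, so that
    sequencing just composes continuations. Instructions outside loops are paid by [csize c], and
    each spent credit releases [W], enough for one loop body and its two jumps. Loops use strong
    induction on the credits, because a body may consume several. *)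
Lemma wp_sound P Post B W c : forall o Q k h M g m e,
  code_at P o (compile o c) -> csize c <= W -> rep B h M g m ->
  wp B c Q k h M ->
  (forall k' h' M' g' m', k' <= k -> rep B h' M' g' m' -> Q k' h' M' ->
     halts_in P Post (W * k' + e) (Config (o + csize c) g' m')) ->
  halts_in P Post (W * k + csize c + e) (Config o g m).
Proof.
elim: c => [r v|r a b|r a b|r f a|f a b|c1 IH1 c2 IH2|r c1 IH1] o Q k h M g m e.
- move=> /code_at_cons [Hi _] _ Hr /= HQ HC.
  apply: halts_in_step (_ : halts_in P Post (W * k + e) _) _; last by lia.
    by rewrite /step Hi.
  by rewrite -addn1; apply: HC HQ => //; apply: rep_reg.
- move=> /code_at_cons [Hi _] _ Hr /= HQ HC.
  apply: halts_in_step (_ : halts_in P Post (W * k + e) _) _; last by lia.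
    by rewrite /step Hi.
  rewrite -addn1; apply: HC HQ => //.
  by case: (Hr) => _ H2 _; rewrite !H2; apply: rep_reg.
- move=> /code_at_cons [Hi _] _ Hr /= HQ HC.
  apply: halts_in_step (_ : halts_in P Post (W * k + e) _) _; last by lia.
    by rewrite /step Hi.
  rewrite -addn1; apply: HC HQ => //.
  by case: (Hr) => _ H2 _; rewrite !H2; apply: rep_reg.
- move=> /code_at_cons [Hi /code_at_cons [Hi' _]] _ Hr /= [/andP [Hf Hx] HQ] HC.
  apply: halts_in_step (_ : halts_in P Post (W * k + e).+1 _) _; last by lia.
    by rewrite /step Hi.
  apply: halts_in_step (_ : halts_in P Post (W * k + e) _) _; last by lia.
    by rewrite /step Hi'.
  rewrite -addn2; apply: HC HQ => //.
  case: (Hr) => H1 H2 H3.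
  have -> : upd g 8 (g f + g (a + 9)) 8 = f * B + h a by rewrite /upd eqxx H1 ?H2.
  rewrite H3 //.
  by apply: rep_reg; apply: rep_scratch.
- move=> /code_at_cons [Hi /code_at_cons [Hi' _]] _ Hr /= [/andP [Hf Hx] HQ] HC.
  apply: halts_in_step (_ : halts_in P Post (W * k + e).+1 _) _; last by lia.
    by rewrite /step Hi.
  apply: halts_in_step (_ : halts_in P Post (W * k + e) _) _; last by lia.
    by rewrite /step Hi'.
  rewrite -addn2; apply: HC HQ => //.
  case: (Hr) => H1 H2 H3.
  have -> : upd g 8 (g f + g (a + 9)) (b + 9) = h b.
    by rewrite /upd; case: eqP => [?|_]; [lia|exact: H2].
  have -> : upd g 8 (g f + g (a + 9)) 8 = f * B + h a by rewrite /upd eqxx H1 ?H2.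
  by apply: rep_mem => //; apply: rep_scratch.
- move=> /= Hc HW Hr Hwp HC.
  rewrite -addnA -addnA addnA.
  apply: (IH1 _ _ _ _ _ _ _ _ (code_at_catl Hc)) Hwp _ => //; first lia.
  move=> k' h' M' g' m' Hk Hr' Hwp'; rewrite addnA.
  have := code_at_catr Hc; rewrite size_compile => Hc2.
  apply: (IH2 _ _ _ _ _ _ _ _ Hc2) Hwp' _ => //; first lia.
  move=> k2 h2 M2 g2 m2 Hk2 Hr2 HQ2; rewrite -addnA.
  by apply: (HC _ _ _ _ _ _ Hr2 HQ2); lia.
- move=> /= /code_at_cons [Hi Hc] HW Hr [I [HI Hwp]].
  have Hcb := code_at_catl Hc.
  have := code_at_catr Hc; rewrite size_compile => /code_at_cons [Hj _].
  elim/ltn_ind: k h M g m Hr HI => k IHk h M g m Hr HI HC.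
  case: (Hr) => H1 H2 H3; have := Hwp _ _ _ HI.
  case: eqP => [h0|h0] Hnext.
    apply: halts_in_step (_ : halts_in P Post (W * k + e) _) _; last by lia.
      by rewrite /step Hi H2 h0 eqxx.
    by rewrite -addnA; apply: (HC _ _ _ _ _ _ Hr Hnext).
  case: Hnext => k0 Hb.
  (* After the body there remain one step for the jump back and a fresh [csize c1 + 2] for
     re-entering the loop; the spent credit covers the difference. *)
  apply: halts_in_step (_ : halts_in P Post
     (W * k.-1 + csize c1 + (csize c1 + 2 + e).+1) (Config o.+1 g m)) _.
  + by rewrite /step Hi H2; case: eqP.
  + apply: (IH1 _ _ _ _ _ _ _ _ Hcb) Hb _ => //; first lia.
    move=> k' h' M' g' m' Hk' Hr' HI'.
    apply: halts_in_step (_ : halts_in P Post (W * k' + (csize c1 + 2) + e) _) _; last by lia.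
      case: (Hr') => H1' _ _.
      by rewrite /step Hj H1'.
    apply: IHk Hr' HI' _; first lia.
    move=> k2 h2 M2 g2 m2 Hk2; apply: HC; lia.
  + have -> : k = k.-1.+1 by lia.
    rewrite mulnS /=; lia.
Qed.

(** * The program *)

Local Notation nrule := (nat * seq nat)%type.

Definition encode_rules (rs : seq nrule) : seq nat :=
  flatten [seq r.1 :: size r.2 :: r.2 | r <- rs].

Definition target (rs : seq nrule) j := (nth (0, [::]) rs j).1.
Definition source (rs : seq nrule) j := (nth (0, [::]) rs j).2.

(** Decreasing order of indices, because parsing inserts every new cell at the head of its list. *)
Definition occ (rs : seq nrule) (a : nat) :=
  [seq j <- rev (iota 0 (size rs)) | a \in source rs j].

Definition cost (rs : seq nrule) := sumn [seq (size r.2).+1 | r <- rs].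

(** The bound [b] will be the current input position: all cells of existing lists lie below it, so
    filling cell [b] leaves them intact. *)
Fixpoint chain (M : nat -> nat -> nat) b x l :=
  if l is j :: l' then
    [&& 0 < x, x < b, M 2 x == j & chain M b (M 1 x) l']
  else x == 0.

Lemma chain_ext (M M' : nat -> nat -> nat) b b' x l :
  (forall y, y < b -> M' 1 y = M 1 y /\ M' 2 y = M 2 y) -> b <= b' ->
  chain M b x l -> chain M' b' x l.
Proof.
move=> HM Hb; elim: l x => //= j l IH x /and4P [x0 xb /eqP <- Hc].
have [-> ->] := HM _ xb.
by rewrite x0 (leq_trans xb Hb) eqxx IH.
Qed.

Lemma source_rcons D r j :
  source (rcons D r) j = if j == size D then r.2 else source D j.
Proof.
rewrite /source nth_rcons; case: ltngtP => // H.
by rewrite nth_default // ltnW.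
Qed.

Lemma target_rcons D r j :
  target (rcons D r) j = if j == size D then r.1 else target D j.
Proof.
rewrite /target nth_rcons; case: ltngtP => // H.
by rewrite nth_default // ltnW.
Qed.

Lemma occ_rcons D r a :
  occ (rcons D r) a = nseq (a \in r.2) (size D) ++ occ D a.
Proof.
rewrite /occ size_rcons -addn1 iotaD rev_cat filter_cat /= source_rcons eqxx.
congr (_ ++ _); first by case: (_ \in _).
apply: eq_in_filter => j; rewrite mem_rev mem_iota => Hj.
by rewrite source_rcons; case: eqP => // E; lia.
Qed.

Lemma mem_occ rs a j : (j \in occ rs a) = (j < size rs) && (a \in source rs j).
Proof. by rewrite /occ mem_filter mem_rev mem_iota andbC. Qed.

Lemma count_nth_iota (rs : seq nrule) (p : pred nat) (p' : pred nrule) :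
  (forall j, j < size rs -> p j = p' (nth (0, [::]) rs j)) ->
  count p (iota 0 (size rs)) = count p' rs.
Proof.
move=> H; rewrite -[in RHS](mkseq_nth (0, [::]) rs) /mkseq count_map.
by apply: eq_in_count => j; rewrite mem_iota => Hj; exact: H.
Qed.

Lemma count_remove (T : eqType) (s : seq T) (p p' : pred T) x :
  uniq s -> x \in s -> ~~ p' x -> (forall y, y != x -> p y = p' y) ->
  count p s = p x + count p' s.
Proof.
move=> us xs px' H.
have /permP perm := perm_to_rem xs.
rewrite !perm /= (negbTE px') add0n; congr addn.
apply: eq_in_count => y; rewrite mem_rem_uniq // => /andP [ne _]; exact: H.
Qed.

(* Variables: 0 the constant 1, 1 the ground set size n, 2 input pointer,
   3 rule index j, 4 rules left to parse, 5 target q of rule j, 6 elements left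
   to parse in rule j (in [satisfy]: 1 iff rule j was unsatisfied), 7 element a,
   8 and 9 temporaries, 10 list cell, 11 queue end, 12 queue front, 13 queue
   length.
   Arrays: 0 input and output, 1 next cell, 2 rule of a cell, 3 head of the
   list of a, 4 counter of a, 5 nonzero iff rule j is satisfied, 6 queue,
   7 target of rule j.  The cell of an occurrence is its input address, which
   is positive, so 0 ends a list.
   Truncated subtraction replaces tests: 1 - x is 1 iff x = 0. *)
Definition parse_item :=
  (CLoad 7 0 2 ;; CLoad 8 3 7 ;; CStore 1 2 8 ;; CStore 2 2 3 ;; CStore 3 7 2 ;;
   (* One of the two truncated differences of a and q vanishes; one minus their sum is 1 iff a = q.
      A rule with its target in its source is accepted by every set, hence marked satisfied at
      once. *)
   CSub 8 7 5 ;; CSub 9 5 7 ;; CAdd 8 8 9 ;; CSub 8 0 8 ;;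
   CLoad 9 5 3 ;; CAdd 9 9 8 ;; CStore 5 3 9 ;; CAdd 2 2 0 ;; CSub 6 6 0)%cmd.

Definition parse_rule :=
  (CLoad 5 0 2 ;; CAdd 2 2 0 ;; CLoad 6 0 2 ;; CAdd 2 2 0 ;; CStore 7 3 5 ;;
   CWhile 6 parse_item ;;
   CLoad 8 5 3 ;; CSub 8 0 8 ;; CLoad 9 4 5 ;; CAdd 8 9 8 ;; CStore 4 5 8 ;;
   CAdd 3 3 0 ;; CSub 4 4 0)%cmd.

Definition parse :=
  (CConst 0 1 ;; CConst 7 0 ;; CLoad 1 0 7 ;; CLoad 4 0 0 ;; CAdd 2 1 0 ;;
   CAdd 2 2 0 ;; CConst 3 0 ;;
   CWhile 4 parse_rule)%cmd.

(** The push is free of branches: the element is always stored at the queue end, and only the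
    advance of the end, by 1 or 0, decides whether it stays. *)
Definition enqueue_free :=
  (CSub 7 7 0 ;; CConst 8 2 ;; CAdd 8 7 8 ;; CLoad 10 0 8 ;;
   CLoad 8 4 7 ;; CAdd 8 8 0 ;; CSub 8 8 10 ;; CStore 4 7 8 ;;
   CSub 9 0 8 ;; CStore 6 11 7 ;; CAdd 11 11 9)%cmd.

(** The queue end advances by [u - c], with [u] telling whether the rule was unsatisfied and [c] the
    new counter: this is 1 only when the counter has just dropped to zero. *)
Definition satisfy :=
  (CLoad 3 2 10 ;; CLoad 5 7 3 ;; CLoad 8 5 3 ;; CSub 6 0 8 ;; CStore 5 3 0 ;;
   CLoad 8 4 5 ;; CSub 8 8 6 ;; CStore 4 5 8 ;;
   CSub 6 6 8 ;; CStore 6 11 5 ;; CAdd 11 11 6 ;; CLoad 10 1 10)%cmd.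

Definition process :=
  (CLoad 7 6 12 ;; CAdd 12 12 0 ;; CLoad 10 3 7 ;; CWhile 10 satisfy ;; CSub 13 11 12)%cmd.

Definition output :=
  (CSub 7 7 0 ;; CLoad 8 4 7 ;; CSub 8 0 8 ;; CStore 0 7 8)%cmd.

Definition search :=
  (CConst 11 0 ;; CConst 8 0 ;; CAdd 7 1 8 ;; CWhile 7 enqueue_free ;;
   CConst 12 0 ;; CSub 13 11 12 ;; CWhile 13 process ;;
   CConst 8 0 ;; CAdd 7 1 8 ;; CWhile 7 output)%cmd.

Definition interior_cmd := (parse ;; search)%cmd.

(** * Correctness of parsing *)

Section Correctness.
Variables (n B : nat) (xb : seq bool) (rs : seq nrule).
Let inp := n :: size rs :: map nat_of_bool xb ++ encode_rules rs.
Hypothesis size_xb : size xb = n.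
Hypothesis target_lt : forall r, r \in rs -> r.1 < n.
Hypothesis source_lt : forall r a, r \in rs -> a \in r.2 -> a < n.
Hypothesis source_uniq : forall r, r \in rs -> uniq r.2.
Hypothesis size_inp : size inp <= B.
Hypothesis n_lt_B : n + 2 <= B.
Hypothesis size_rs_lt : size rs < B.

(** The second clause ranges over all [j < B]: past the parsed rules the default rule has an empty
    source, so array 5 is still zero there. *)
Definition parsed i (D : seq nrule) (M : nat -> nat -> nat) :=
  [/\ forall j, j < size D -> M 7 j = target D j,
      forall j, j < B -> (M 5 j == 0) = (target D j \notin source D j)
    & forall a, a < n -> chain M i (M 3 a) (occ D a)].

Definition counted (D : seq nrule) (M : nat -> nat -> nat) :=
  forall a, a < n -> M 4 a = count (fun r => (r.1 == a) && (r.1 \notin r.2)) D.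

Definition input_intact (M : nat -> nat -> nat) :=
  forall x, x < B -> M 0 x = nth 0 inp x.

(** The rule being read counts as a rule whose source is the part [A1] already consumed. The [k0]
    credits are reserved for what follows the loop. *)
Definition items_inv (D : seq nrule) q (A : seq nat) (todo : seq nrule) k0 k (h : nat -> nat) M :=
  exists A1 A2 : seq nat,
  [/\ A = A1 ++ A2, k0 + size A2 <= k, drop (h 2) inp = A2 ++ encode_rules todo,
      h 6 = size A2 & parsed (h 2) (rcons D (q, A1)) M] /\
  [/\ h 0 = 1, h 1 = n, h 3 = size D, h 4 = (size todo).+1 & h 5 = q] /\
  [/\ counted D M, input_intact M & 0 < h 2 <= B].

Lemma drop_inpE i x l : drop i inp = x :: l ->
  [/\ i < B, nth 0 inp i = x & drop i.+1 inp = l].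
Proof.
move=> E; have Hs : i < size inp.
  by rewrite ltnNge; apply/negP => H; rewrite drop_oversize in E.
move: E; rewrite (drop_nth 0 Hs) => -[<- <-]; split=> //; exact: leq_trans Hs size_inp.
Qed.

Lemma parse_item_wp D q A todo k0 k h M :
  rs = D ++ (q, A) :: todo ->
  items_inv D q A todo k0 k h M -> h 6 != 0 ->
  0 < k /\ wp B parse_item (items_inv D q A todo k0) k.-1 h M.
Proof.
move=> Ers [A1 [A2 [[EA Hk Hd H6 [Ptg Psat Pch]] [[H0 H1 H3 H4 H5] [Hcnt Hin i_gt0]]]]].
case: A2 => [|a A2] in EA Hk Hd H6 *; first by rewrite H6.
move=> _; have [iB /esym Ea Hd'] := drop_inpE Hd.
have rin : (q, A) \in rs by rewrite Ers mem_cat inE eqxx orbT.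
have a_n : a < n by apply: (source_lt rin); rewrite EA mem_cat inE eqxx orbT.
(* As sources have no repetitions, the current rule is not yet in the list of [a]. *)
have aA1 : a \notin A1.
  by have := source_uniq rin; rewrite EA /= cat_uniq /= => /and3P [_ /norP [? _] _].
have DB : size D < B by move: size_rs_lt; rewrite Ers size_cat /=; lia.
split; first by move: Hk => /=; lia.
rewrite /= /upd2 /upd /= H0 H3 H5 Hin // -Ea.
do 7 (split; first lia).
exists (rcons A1 a), A2; split; [split|] => //=.
- by rewrite cat_rcons.
- by move: Hk => /=; lia.
- by rewrite addn1.
- by rewrite H6 /=; lia.
- split=> /=.
  + by move=> j; rewrite size_rcons target_rcons => Hj; rewrite Ptg ?size_rcons // target_rcons.
  + move=> j jB; have := Psat j jB; rewrite !target_rcons !source_rcons.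
    case: (j =P size D) => [->|_] //= E; rewrite mem_rcons in_cons negb_or -E.
    by rewrite addn_eq0 andbC; congr (_ && _); lia.
  + move=> b b_n; set M' := (X in chain X).
    have ext x l : chain M (h 2) x l -> chain M' (h 2 + 1) x l.
      apply: chain_ext; last lia.
      by move=> y Hy; rewrite /M' /= !ifF //; lia.
    have := Pch b b_n; rewrite !occ_rcons /= mem_rcons in_cons /M' /= -/M'.
    case: (b =P a) => [->|_] /=; last exact: ext.
    rewrite /M' /= (negbTE aA1) (_ : 0 < h 2) ?(proj1 (andP i_gt0)) // !eqxx /= => /ext ->.
    by rewrite addn1 ltnSn.
split; first by [].
by split; [exact: Hcnt | exact: Hin | lia].
Qed.

Definition rules_inv k0 k (h : nat -> nat) M :=
  exists D todo : seq nrule,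
  [/\ rs = D ++ todo, k0 + cost todo <= k, drop (h 2) inp = encode_rules todo
    & parsed (h 2) D M] /\ [/\ h 0 = 1, h 1 = n, h 3 = size D & h 4 = size todo] /\
  [/\ counted D M, input_intact M & 0 < h 2 <= B].

Lemma parse_rule_wp k0 k h M :
  rules_inv k0 k h M -> h 4 != 0 ->
  0 < k /\ wp B parse_rule (rules_inv k0) k.-1 h M.
Proof.
move=> [D [todo [[Ers Hk Hd [Ptg Psat Pch]] [[H0 H1 H3 H4] [Hcnt Hin i_gt0]]]]].
case: todo => [|[q A] todo] in Ers Hk Hd H4 *; first by rewrite H4.
have {}Hd : drop (h 2) inp = q :: size A :: A ++ encode_rules todo := Hd.
move=> _; have [iB /esym Eq Hd'] := drop_inpE Hd.
have [iB' /esym Ed Hd2] := drop_inpE Hd'.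
have DB : size D < B by move: size_rs_lt; rewrite Ers size_cat /=; lia.
split; first by move: Hk; rewrite /cost /=; lia.
rewrite /= /upd2 /upd /= H0 H3 addn1 !Hin // -Eq -Ed.
do 3 (split; first lia).
exists (items_inv D q A todo (k0 + cost todo)); split.
  exists [::], A; split; [split|] => //=.
  - by move: Hk; rewrite /cost /=; lia.
  - by rewrite addn1.
  - split=> /=.
    + move=> j; rewrite size_rcons target_rcons; case: eqP => // ne Hj.
      by rewrite Ptg //; lia.
    + move=> j jB; rewrite source_rcons target_rcons Psat //.
      case: eqP => // ->; by rewrite /source nth_default.
    + move=> b b_n; rewrite occ_rcons /=; apply: chain_ext (Pch b b_n) => //; lia.
  by split; split=> //; lia.
move=> k' h' M' HI; case: (h' 6 =P 0) => [h0 | /eqP h0]; last exact: parse_item_wp HI h0.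
case: HI => A1 [A2 [[EA Hk' Hd3 H6' [Ptg' Psat' Pch']]]].
move=> [[H0' H1' H3' H4' H5'] [Hcnt' Hin' i_gt0']].
have A20 : A2 = [::] by apply: size0nil; rewrite -H6'.
move: EA Hk' Hd3; rewrite A20 cats0 addn0 /= => EA Hk' Hd3.
rewrite -EA in Ptg' Psat' Pch'.
have q_n : q < n by apply: (@target_lt (q, A)); rewrite Ers mem_cat inE eqxx orbT.
rewrite /= H3' H5' H0' H4'; split; first by lia.
do 2 (split; first lia).
exists (rcons D (q, A)), todo; split; [split|] => //=.
- by rewrite cat_rcons.
- by split=> // a a_n; apply: chain_ext (Pch' a a_n).
- rewrite size_rcons addn1 subn1; split; first by [].
  split=> // a a_n; rewrite -cats1 count_cat -Hcnt' //=.
  case: (a =P q) => [->|ne]; last first.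
    by rewrite (_ : (q == a) = false) ?addn0 //; apply/eqP => E; case: ne.
  rewrite eqxx /=.
  have := Psat' _ DB; rewrite source_rcons target_rcons eqxx /=.
  by case: (q \in A) => /=; lia.
Qed.

Lemma parse_wp Q k h M :
  input_intact M ->
  (forall f x, 0 < f -> f < 8 -> x < B -> M f x = 0) ->
  cost rs <= k ->
  (forall k' h' M' i, k <= k' + cost rs -> h' 0 = 1 -> h' 1 = n -> i <= B ->
     parsed i rs M' -> counted rs M' ->
     input_intact M' -> Q k' h' M') ->
  wp B parse Q k h M.
Proof.
move=> Hin Hz Hk HQ.
rewrite /= /upd /= !Hin //; try lia.
do 2 (split; first lia).
exists (rules_inv (k - cost rs)); split.
  exists [::], rs; split; [split|] => //=.
  - lia.
  - rewrite addn1 addn1 /= drop_size_cat // size_map; lia.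
  - split=> // [j jB|a a_n]; rewrite /= ?Hz //; last by lia.
    by rewrite /source nth_nil.
  split; first by [].
  split=> // [a a_n|]; last by lia.
  by rewrite Hz //; lia.
move=> k' h' M' HI; case: (h' 4 =P 0) => [h0 | /eqP h0]; last exact: parse_rule_wp HI h0.
case: HI => D [todo [[ED Hk' _ HP] [[H0 H1 H3 H4] [Hcnt Hin' i_B]]]].
have E : todo = [::] by apply: size0nil; rewrite -H4.
rewrite E cats0 in ED; rewrite -ED in HP Hcnt.
by apply: HQ HP _ _ => //; move: Hk' i_B; rewrite E /cost /=; lia.
Qed.

(** * Derivations, counters and the queue *)

Let allowed a := nth false xb a.

(** Enumerations, element by element, of chains of $\mathcal{A}(\mathcal{R})$ inside $X$. Only rules
    with target [q] have to be checked when [q] is added, since the others remain accepted. *)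
Inductive derivation : seq nat -> Prop :=
| derivation_nil : derivation [::]
| derivation_rcons s q : derivation s -> q < n -> q \notin s -> allowed q ->
    (forall r, r \in rs -> r.1 = q -> (q \in r.2) || has (mem s) r.2) ->
    derivation (rcons s q).

Lemma derivation_uniq s : derivation s -> uniq s /\ {subset s <= iota 0 n}.
Proof.
elim=> // {}s q _ [us sub] q_n qs _ _; rewrite rcons_uniq qs; split=> // x.
by rewrite mem_rcons inE => /predU1P [->|/sub //]; rewrite mem_iota.
Qed.

Lemma derivation_size s : derivation s -> size s <= n.
Proof.
by move=> /derivation_uniq [us sub]; rewrite -(size_iota 0 n); apply: uniq_leq_size.
Qed.

Definition unsat (M : nat -> nat -> nat) q :=
  count (fun j => (target rs j == q) && (M 5 j == 0)) (iota 0 (size rs)).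

Definition linked b M :=
  (forall j, j < size rs -> M 7 j = target rs j) /\
  (forall a, a < n -> chain M b (M 3 a) (occ rs a)).

Lemma has_mem_catl (s t l : seq nat) : has (mem s) l -> has (mem (s ++ t)) l.
Proof. by apply: sub_has => x /= xs; rewrite mem_cat xs. Qed.

Lemma linked_ext b M M' :
  M' 1 = M 1 -> M' 2 = M 2 -> M' 3 = M 3 -> M' 7 = M 7 -> linked b M -> linked b M'.
Proof.
move=> E1 E2 E3 E7 [Ht Hch]; split=> [j jJ|a a_n]; first by rewrite E7 Ht.
by rewrite E3; apply: chain_ext (Hch a a_n) => // y _; rewrite E1 E2.
Qed.

(* [s] is the list of all elements queued so far.  While the queue is being
   initialised, downwards from [n], the elements below [lo] are still to be
   considered and their counters do not account for [X] yet. *)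
Definition state b lo (s : seq nat) (M : nat -> nat -> nat) :=
  [/\ linked b M,
      forall j, j < size rs -> M 5 j != 0 ->
        (target rs j \in source rs j) || has (mem s) (source rs j),
      forall j, j < size rs -> target rs j \in source rs j -> M 5 j != 0
    & forall q, q < n -> M 4 q = unsat M q + (lo <= q) * ~~ allowed q] /\
  [/\ forall q, q < n -> (q \in s) = (lo <= q) && (M 4 q == 0),
      derivation s
    & forall i, i < size s -> M 6 i = nth 0 s i].

(** With no unsatisfied rule left for [q], each rule with target [q] is marked, and a mark certifies
    that its source contains [q] or meets [s]. *)
Lemma derivation_push (M : nat -> nat -> nat) s q :
  (forall j, j < size rs -> M 5 j != 0 ->
     (target rs j \in source rs j) || has (mem s) (source rs j)) ->
  derivation s -> q < n -> q \notin s -> allowed q -> unsat M q = 0 ->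
  derivation (rcons s q).
Proof.
move=> Hs Ds q_n qs q_ok Hu; apply: derivation_rcons => // r rin rq.
have jJ : index r rs < size rs by rewrite index_mem.
have Er : nth (0, [::]) rs (index r rs) = r by rewrite nth_index.
have := Hs _ jJ; rewrite /target /source Er rq; apply.
apply/negP => M0.
have : has (fun j => (target rs j == q) && (M 5 j == 0)) (iota 0 (size rs)).
  by apply/hasP; exists (index r rs); rewrite ?mem_iota // /target Er rq eqxx.
by rewrite has_count -/(unsat M q) Hu.
Qed.

(** For [v = 0] the write lands just past the queue and is harmless, which justifies the
    unconditional store. *)
Lemma queue_push (f : nat -> nat) s q v :
  (forall i, i < size s -> f i = nth 0 s i) ->
  v <= 1 ->
  forall i, i < size (s ++ nseq v q) ->
    upd f (size s) q i = nth 0 (s ++ nseq v q) i.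
Proof.
move=> Hf v1 i; rewrite size_cat size_nseq /upd nth_cat => Hi.
case: (ltnP i (size s)) => Hs; first by rewrite ifF ?Hf //; lia.
have -> : i = size s by lia.
by rewrite eqxx subnn nth_nseq ifT //; lia.
Qed.

Definition enqueue_inv b k0 k (h : nat -> nat) M :=
  exists s : seq nat,
  [/\ state b (h 7) s M, input_intact M, k0 + h 7 <= k & h 7 <= n] /\
  [/\ h 0 = 1, h 1 = n & h 11 = size s].

Lemma enqueue_free_wp b k0 k h M :
  enqueue_inv b k0 k h M -> h 7 != 0 ->
  0 < k /\ wp B enqueue_free (enqueue_inv b k0) k.-1 h M.
Proof.
move=> [s [[[[Hl Hs1 Hs2 Hc] [Hm Ds Hq]] Hin Hk H7] [H0 H1 H11]]].
case E7: (h 7) => [|a] // _.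
rewrite E7 in Hc Hm Hk H7; split; first lia.
have sz := derivation_size Ds.
rewrite /= /upd2 /= /upd /= H0 H11 E7 subn1 /=.
have -> : M 0 (a + 2) = allowed a.
  rewrite Hin; last lia.
  rewrite addn2 /= nth_cat size_map size_xb H7 (nth_map false) ?size_xb //.
have -> : M 4 a = unsat M a by rewrite Hc // ltnn addn0.
do 4 (split; first lia).
set c := _ + 1 - _; set v := 1 - c; set M' := (X in enqueue_inv _ _ _ _ X).
have Ec : c = unsat M a + ~~ allowed a by rewrite /c; case: (allowed a) => /=; lia.
have v1 : v <= 1 by rewrite /v; lia.
have as_ : a \notin s by rewrite Hm // ltnn.
exists (s ++ nseq v a); split; split=> /=; try lia; last by rewrite size_cat size_nseq.
split; split=> //.
- exact: linked_ext Hl.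
- by move=> j jJ M0; have /orP [->//|Hh] := Hs1 j jJ M0; rewrite (has_mem_catl _ Hh) orbT.
- move=> q q_n; rewrite /M' /= Hc //; case: (q =P a) => [->|ne]; first by rewrite leqnn mul1n.
  by rewrite (_ : (a < q) = (a <= q)) //; lia.
- move=> q q_n; rewrite mem_cat Hm // mem_nseq /M' /=.
  case: (q =P a) => [->|ne]; first by rewrite ltnn leqnn andbT /= /v; lia.
  by rewrite andbF orbF (_ : (a < q) = (a <= q)) //; lia.
- rewrite /v; case c0 : c => [|c'] /=; last by rewrite cats0.
  rewrite cats1; move: c0; rewrite Ec => c0.
  by apply: (derivation_push Hs1) => //; [case: (allowed a) c0 => //; lia | lia].
- exact: queue_push.
exact: Hin.
Qed.

(** Only the mark of [j] changes, so the counter and the number of unsatisfied rules of [q] both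
    drop by [u]. If [u - c] is 1, the counter was 1 before, so [q] was not yet queued; it is 0 now,
    so [q] is allowed and unobstructed. *)
Lemma satisfy_state b s a j M :
  state b 0 s M -> a \in s -> j < size rs -> a \in source rs j ->
  let q := target rs j in
  let u := 1 - M 5 j in
  let c := M 4 q - u in
  u - c <= 1 /\
  state b 0 (s ++ nseq (u - c) q)
    (upd2 (upd2 (upd2 M 5 j 1) 4 q c) 6 (size s) q).
Proof.
move=> [[Hl Hs1 Hs2 Hc] [Hm Ds Hq]] a_s jJ aj q u c.
have q_n : q < n by apply: target_lt; apply: mem_nth.
have v1 : u - c <= 1 by rewrite /u; lia.
split=> //; set M' := upd2 _ _ _ _.
have M5 i : M' 5 i = if i == j then 1 else M 5 i by [].
have M4 i : M' 4 i = if i == q then c else M 4 i by [].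
have Hun p : unsat M p = ((p == q) && (M 5 j == 0)) + unsat M' p.
  rewrite /unsat (count_remove (x := j) (p' := fun j => (target rs j == p) && (M' 5 j == 0)))
    ?iota_uniq ?mem_iota //.
  + by rewrite [p == q]eq_sym.
  + by rewrite M5 eqxx andbF.
  + by move=> y /negbTE ny; rewrite M5 ny.
have Hc' p : p < n -> M' 4 p = unsat M' p + ~~ allowed p.
  move=> p_n; rewrite M4; have := Hc _ p_n; rewrite mul1n Hun.
  case: (p =P q) => [->|_] /=; last by [].
  by rewrite /c /u; case: (M 5 j =P 0) => [->|] /=; lia.
have Hs1' : forall i, i < size rs -> M' 5 i != 0 ->
   (target rs i \in source rs i) || has (mem s) (source rs i).
  move=> i iJ; rewrite M5; case: (i =P j) => [->|_]; last exact: Hs1.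
  by move=> _; apply/orP; right; apply/hasP; exists a.
split; split=> //.
- exact: linked_ext Hl.
- move=> i iJ /Hs1' -/(_ iJ) /orP [->//|Hh]; by rewrite (has_mem_catl _ Hh) orbT.
- by move=> i iJ it; have := Hs2 i iJ it; rewrite M5; case: (i =P j).
- by move=> p p_n; rewrite mul1n Hc'.
- move=> p p_n; rewrite mem_cat Hm // mem_nseq M4 /=.
  case: (p =P q) => [->|ne]; last by rewrite andbF orbF.
  by rewrite andbT /c /u; case: (M 5 j =P 0) (Hc _ q_n) (Hun q) => [->|] /=; rewrite ?eqxx /=; lia.
- case Ev : (u - c) => [|v] /=; first by rewrite cats0.
  have -> : v = 0 by lia.
  have q_s : q \notin s.
    rewrite Hm //=; move: Ev; rewrite /c /u.
    have := Hc _ q_n; have := Hun q; rewrite eqxx /=; case: (M 5 j =P 0) => /=; lia.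
  have := Hc' _ q_n; rewrite M4 eqxx => Ec.
  rewrite cats1; apply: (derivation_push Hs1') => //.
    by case: (allowed q) Ec => //=; lia.
  lia.
- exact: queue_push.
Qed.

(** * Processing the queue within an amortised number of iterations *)

Definition weight (a : nat) := (size (occ rs a)).+1.

Definition satisfied (M : nat -> nat -> nat) a :=
  forall j, j < size rs -> a \in source rs j -> M 5 j != 0.

(** [P] has been processed, [a] is in progress, [s] is waiting and [l] is the unvisited rest of the
    list of [a]. The weight of an element pays for its removal from the queue and for each of its
    cells; the credits cover [k0], the weights of all elements outside [P] and [a], and [l]. Moving
    terms across the inequality avoids truncated subtraction. *)
Definition satisfy_inv b k0 (P : seq nat) (a : nat) k (h : nat -> nat) M :=
  exists s l : seq nat,
  [/\ state b 0 (P ++ a :: s) M, chain M b (h 10) l, {subset l <= occ rs a},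
      (forall c, c \in P -> satisfied M c) &
      (forall j, j < size rs -> a \in source rs j -> (j \in l) || (M 5 j != 0))] /\
  [/\ k0 + sumn (map weight (iota 0 n)) + size l <= k + sumn (map weight (rcons P a)),
      h 0 = 1, h 1 = n, h 11 = (size P + size s).+1 & h 12 = (size P).+1].

Definition process_inv b k0 k (h : nat -> nat) M :=
  exists P s : seq nat,
  [/\ state b 0 (P ++ s) M, (forall c, c \in P -> satisfied M c)
    & k0 + sumn (map weight (iota 0 n)) <= k + sumn (map weight P)] /\
  [/\ h 0 = 1, h 1 = n, h 11 = size P + size s, h 12 = size P & h 13 = size s].

Lemma sum_weight_le (s : seq nat) : uniq s -> {subset s <= iota 0 n} ->
  sumn (map weight s) <= sumn (map weight (iota 0 n)).
Proof.
move=> us sub; rewrite !sumnE !big_map.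
by apply: (uniq_sub_le_big leqnn) (iota_uniq 0 n) sub => // x y; exact: leq_addr.
Qed.

Lemma satisfy_wp b k0 (P : seq nat) (a : nat) k h M :
  b <= B -> satisfy_inv b k0 P a k h M -> h 10 != 0 ->
  0 < k /\ wp B satisfy (satisfy_inv b k0 P a) k.-1 h M.
Proof.
move=> bB [s [l [[Hst Hch Hl HP Ha] [Hk H0 H1 H11 H12]]]].
case: l Hch Hl Ha Hk => [/eqP -> //|j l /and4P [x0 x_b /eqP Ej Hch]] Hl Ha Hk _.
rewrite /= in Hk.
have [_ Ds _] := Hst.2; have [us sub] := derivation_uniq Ds.
(* The queue has no repetitions, so the weights already used do not exceed the total, and a credit
   is left for the current cell. *)
have Hw : sumn (map weight (rcons P a)) <= sumn (map weight (iota 0 n)).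
  apply: sum_weight_le.
    by move: us; rewrite -cat_rcons cat_uniq => /and3P [].
  by move=> c cP; apply: sub; rewrite -cat_rcons mem_cat cP.
split; first by lia.
have : j \in occ rs a by apply: Hl; rewrite mem_head.
rewrite mem_occ => /andP [jJ aj].
have q_n : target rs j < n by apply: target_lt; apply: mem_nth.
have sz : size (P ++ a :: s) <= n := derivation_size Ds.
have a_s : a \in P ++ a :: s by rewrite mem_cat mem_head orbT.
have [v1 Hst'] := satisfy_state Hst a_s jJ aj.
have [[[Ht _] _ _ _] _] := Hst.
have Es : (size P + size s).+1 = size (P ++ a :: s) by rewrite size_cat addnS.
rewrite /= /upd /= Ej Ht // H0 H11 Es {1 2 3 4 5}/upd2 /=.
do 8 (split; first lia).
exists (s ++ nseq (1 - M 5 j - (M 4 (target rs j) - (1 - M 5 j))) (target rs j)), l.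
split; split => //=.
- by rewrite -cat_cons catA.
- by apply: chain_ext Hch.
- by move=> i il; apply: Hl; rewrite inE il orbT.
- move=> c cP i iJ ci; rewrite /upd2 /= /upd; case: (i =P j) => // _; exact: (HP c cP).
- move=> i iJ ai; rewrite /upd2 /= /upd; case: (i =P j) => [_|ne]; first by rewrite orbT.
  by have := Ha i iJ ai; rewrite inE; case: (i =P j) ne.
- lia.
- by rewrite -Es !size_cat size_nseq; lia.
Qed.

Lemma process_wp b k0 k h M :
  b <= B -> process_inv b k0 k h M -> h 13 != 0 ->
  0 < k /\ wp B process (process_inv b k0) k.-1 h M.
Proof.
move=> bB [P [s [[Hst HP Hk] [H0 H1 H11 H12 H13]]]].
case: s => [|a s] in Hst H11 H13 *; first by rewrite H13.
move=> _; have [_ Ds Hq] := Hst.2; have [us sub] := derivation_uniq Ds.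
have Hw : sumn (map weight (rcons P a)) <= sumn (map weight (iota 0 n)).
  apply: sum_weight_le.
    by move: us; rewrite -cat_rcons cat_uniq => /and3P [].
  by move=> c cP; apply: sub; rewrite -cat_rcons mem_cat cP.
move: (Hw); rewrite map_rcons -cats1 sumn_cat /= addn0 => Hw'.
have wa : 0 < weight a by [].
split; first lia.
have a_n : a < n by have := sub a; rewrite mem_iota mem_cat mem_head orbT => /(_ isT).
have sz : size (P ++ a :: s) <= n := derivation_size Ds.
have Ea : M 6 (size P) = a.
  by rewrite Hq ?nth_cat ?ltnn ?subnn // size_cat /=; lia.
rewrite /= /upd /= H12 Ea H0.
move: sz; rewrite size_cat /= => sz.
do 2 (split; first lia).
exists (satisfy_inv b k0 P a); split.
  exists s, (occ rs a); split; split=> //=.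
  - by case: Hst => [[[_ Hch] _ _ _] _]; exact: Hch.
  - by move=> j jJ aj; rewrite mem_occ jJ aj.
  - have Ew : weight a = (size (occ rs a)).+1 by [].
    by rewrite map_rcons -cats1 sumn_cat /= addn0 Ew; lia.
  - by rewrite H11 addnS.
  - by rewrite addn1.
move=> k' h' M' HI; case: (h' 10 =P 0) => [h0 | /eqP h0]; last exact: satisfy_wp HI h0.
case: HI => s' [l [[Hst' Hch Hl HP' Ha] [Hk' H0' H1' H11' H12']]].
have l0 : l = [::] by case: l Hch {Hl Ha Hk'} => //= j l; rewrite h0.
exists (rcons P a), s'; split; split=> //=.
- by rewrite cat_rcons.
- move=> c; rewrite mem_rcons inE => /predU1P [->|]; last exact: HP'.
  by move=> j jJ aj; have := Ha j jJ aj; rewrite l0.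
- by move: Hk'; rewrite l0 addn0.
- by rewrite H11' size_rcons addSn.
- by rewrite H12' size_rcons.
- by rewrite H11' H12'; lia.
Qed.

Definition maximal (s : seq nat) := forall q, q < n -> q \notin s -> allowed q ->
  exists r, [/\ r \in rs, r.1 = q, q \notin r.2 & ~~ has (mem s) r.2].

(** An allowed element outside the queue has a nonzero counter, hence an unmarked rule. Its source
    avoids the target, as such rules are marked from the beginning, and avoids [s], all of whose
    rules have been marked. *)
Lemma processed_maximal b s M :
  state b 0 s M -> (forall c, c \in s -> satisfied M c) -> maximal s.
Proof.
move=> [[Hl Hs1 Hs2 Hc] [Hm Ds Hq]] HP q q_n q_s q_ok.
have : 0 < unsat M q.
  have := Hc q q_n; rewrite q_ok muln0 addn0 => <-.
  by move: q_s; rewrite Hm // lt0n.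
rewrite -has_count => /hasP [j]; rewrite mem_iota => jJ /andP [/eqP Eq /eqP M0].
exists (nth (0, [::]) rs j); split=> //; first exact: mem_nth.
  by apply/negP => qA; have := Hs2 j jJ; rewrite Eq M0 => /(_ qA).
by apply/hasPn => c cA; apply/negP => /= cs; have := HP c cs j jJ cA; rewrite M0.
Qed.

Definition output_inv (s : seq nat) k (h : nat -> nat) (M : nat -> nat -> nat) :=
  [/\ forall q, q < n -> (q \in s) = (M 4 q == 0),
      forall q, q < n -> h 7 <= q -> (M 0 q != 0) = (q \in s)
    & h 7 <= k] /\ [/\ h 0 = 1 & h 7 <= n].

Lemma output_wp s k h M :
  output_inv s k h M -> h 7 != 0 ->
  0 < k /\ wp B output (output_inv s) k.-1 h M.
Proof.
move=> [[Hm Ho Hk] [H0 H7]] h7; split; first lia.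
rewrite /= /upd /= H0; split; first lia.
split; first lia.
split; split=> //=; try lia.
move=> q q_n Hq; rewrite /upd2 /= /upd.
case: (q =P h 7 - 1) => [<-|ne]; last by apply: Ho => //; lia.
by rewrite Hm //; lia.
Qed.

(** Double counting of occurrences: each rule adds at most one cell per element of its source. *)
Lemma sum_occ_le (R : seq nrule) (m : nat) :
  sumn [seq (size (occ R a)).+1 | a <- iota 0 m] <= m + cost R.
Proof.
elim/last_ind: R => [|R r IH].
  rewrite /cost addn0 (_ : map _ _ = nseq m 1) ?sumn_nseq ?mul1n //.
  by apply: (@eq_from_nth _ 0) => [|i]; rewrite size_map size_iota ?size_nseq // => i_m;
     rewrite (nth_map 0) ?size_iota // nth_nseq i_m.
rewrite /cost -cats1 map_cat sumn_cat -/(cost R) /= addn0.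
have -> : sumn [seq (size (occ (R ++ [:: r]) a)).+1 | a <- iota 0 m] =
  count (fun x => x \in r.2) (iota 0 m) + sumn [seq (size (occ R a)).+1 | a <- iota 0 m].
  rewrite cats1; elim: (iota 0 m) => //= a l ->.
  by rewrite occ_rcons size_cat size_nseq -addnS addnACA.
suff H : count (fun x => x \in r.2) (iota 0 m) <= size r.2.
  by apply: leq_trans (leq_add H IH) _; lia.
rewrite -size_filter; apply: uniq_leq_size; first by rewrite filter_uniq ?iota_uniq.
by move=> x; rewrite mem_filter => /andP [].
Qed.

(** The credits split into [cost rs] for parsing, [n] for filling the queue, [n + cost rs] for
    processing it and [n] for the output. *)
Lemma interior_cmd_wp h M :
  input_intact M -> (forall f x, 0 < f -> f < 8 -> x < B -> M f x = 0) ->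
  wp B interior_cmd
    (fun _ _ M' => exists s, [/\ derivation s, maximal s &
       forall q, q < n -> (M' 0 q != 0) = (q \in s)])
    (3 * n + 2 * cost rs) h M.
Proof.
move=> Hin Hz; have HT : sumn (map weight (iota 0 n)) <= n + cost rs := sum_occ_le rs n.
rewrite -[wp _ _ _]/(wp B parse (wp B search _)).
apply: parse_wp => //; first by lia.
move=> {h M Hin Hz} k h M b Hk H0 H1 bB [Ht Hs Hch] Hcnt Hin.
rewrite /= /upd /= H1 addn0.
set k0 := 2 * n + cost rs.
exists (enqueue_inv b k0); split.
  exists [::]; split; split=> //=; try lia.
  split; split=> //.
  - move=> j jJ; rewrite Hs ?negbK; last lia.
    by move=> ->.
  - by move=> j jJ jj; rewrite Hs ?jj //; lia.
  - move=> q q_n; rewrite Hcnt // leqNgt q_n addn0 /unsat; symmetry.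
    apply: count_nth_iota => j jJ; by rewrite Hs //; lia.
  - by move=> q q_n; rewrite leqNgt q_n.
  - exact: derivation_nil.
move=> k1 h1 M1 HI; case: (h1 7 =P 0) => [h0 | /eqP h0]; last exact: enqueue_free_wp HI h0.
case: HI => s [[Hst _ Hk1 _] [H0' H1' H11]]; rewrite h0 in Hst Hk1.
exists (process_inv b n); split.
  exists [::], s; split; split=> //=; rewrite ?H11 //; lia.
move=> k2 h2 M2 HI; case: (h2 13 =P 0) => [h20 | /eqP h20]; last exact: process_wp HI h20.
case: HI => P [t [[Hst2 HP Hk2] [H02 H12 _ _ H13]]].
have t0 : t = [::] by apply: size0nil; rewrite -H13.
rewrite t0 cats0 in Hst2.
have Hmax := processed_maximal Hst2 HP.
have [_ [Hm Ds _]] := Hst2.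
have HPw : sumn (map weight P) <= sumn (map weight (iota 0 n)).
  by have [uP sP] := derivation_uniq Ds; apply: sum_weight_le.
exists (output_inv P); split.
  split; split=> //=; rewrite ?H12; try lia.
move=> k3 h3 M3 HI; case: (h3 7 =P 0) => [h30 | /eqP h30]; last exact: output_wp HI h30.
case: HI => [[_ Ho _] _]; exists P; split=> // q q_n.
by apply: Ho; rewrite ?h30.
Qed.
End Correctness.

(** * From the queue to the interior *)

Section Interior.
Variables (n : nat) (R : seq (rule 'I_n)) (X : {set 'I_n}).

Definition nat_rules : seq (nat * seq nat) :=
  [seq (nat_of_ord r.2, [seq nat_of_ord a | a <- enum r.1]) | r : {set 'I_n} * 'I_n <- R].
Definition nat_set : seq bool := [seq i \in X | i <- enum 'I_n].

Lemma encodeE :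
  encode R X = n :: size nat_rules :: map nat_of_bool nat_set ++ encode_rules nat_rules.
Proof.
rewrite /encode /nat_set /nat_rules /encode_rules size_map -!map_comp /=.
congr [:: _, _ & _ ++ flatten _].
by apply: eq_map => r /=; rewrite size_map -cardE.
Qed.

Lemma cost_nat_rules : cost nat_rules = lsize R.
Proof.
rewrite /cost /lsize /nat_rules sumnE big_map big_map; apply: eq_bigr => r _ /=.
by rewrite size_map -cardE addn1.
Qed.

Lemma mem_source (A : {set 'I_n}) (a : 'I_n) :
  (nat_of_ord a \in [seq nat_of_ord a | a <- enum A]) = (a \in A).
Proof. by rewrite mem_map ?mem_enum //; apply: val_inj. Qed.

Lemma nth_nat_set (i : 'I_n) : nth false nat_set i = (i \in X).
Proof. by rewrite (nth_map i) ?size_enum_ord // nth_ord_enum. Qed.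

Definition to_set (s : seq nat) : {set 'I_n} := [set i : 'I_n | nat_of_ord i \in s].

(** The prefixes form the chain. A rule with target [q] accepts the enlarged set by the derivation;
    one whose target was present before already had its source met. *)
Lemma derivation_inA s :
  derivation n nat_set nat_rules s -> inA R (to_set s) /\ to_set s \subset X.
Proof.
elim=> [|{}s q _ [[Ys [pathY lastY allY]] sX] q_n q_s q_ok Hq].
  have -> : to_set [::] = set0 by apply/setP => i; rewrite !inE.
  split; last exact: sub0set.
  exists [::]; split=> //=; rewrite andbT.
  by apply/allP => r _; rewrite /accepts inE.
have E : to_set (rcons s q) = Ordinal q_n |: to_set s.
  by apply/setP => i; rewrite !inE mem_rcons inE.
have qY : Ordinal q_n \notin to_set s by rewrite inE.
split; last first.
  rewrite E subUset sX andbT sub1set -nth_nat_set; exact: q_ok.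
exists (rcons Ys (to_set (rcons s q))); split; last 1 first.
- rewrite -rcons_cons all_rcons allY andbT; apply/allP => r rR.
  apply/implyP; rewrite E in_setU1 => /predU1P [Er|rY].
    have /(_ _ _)/orP := Hq (nat_of_ord r.2, [seq nat_of_ord a | a <- enum r.1]).
    case=> [||qr|/hasP [x /mapP [a]]]; first exact: map_f.
    + by rewrite Er.
    + apply/set0Pn; exists (Ordinal q_n); rewrite !inE eqxx -mem_source; exact: qr.
    + rewrite mem_enum => ar -> /= as_; apply/set0Pn; exists a.
      by rewrite !inE as_ orbT ar.
  have /allP/(_ r rR) : inK R (to_set s) by rewrite -lastY (allP allY) ?mem_last.
  rewrite /accepts rY /= => /set0Pn [a]; rewrite !inE => /andP [as_ ar].
  by apply/set0Pn; exists a; rewrite !inE as_ orbT ar.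
- rewrite rcons_path pathY lastY /= E subsetUr /=.
  rewrite setDUl setDv setU0; apply/cards1P; exists (Ordinal q_n).
  by apply/setDidPl; rewrite disjoints1.
- by rewrite last_rcons.
Qed.

Lemma path_subset_last (A : {set 'I_n}) Ys :
  path (fun Y Y' : {set 'I_n} => (Y \subset Y') && (#|Y' :\: Y| == 1)) A Ys ->
  A \subset last A Ys.
Proof.
elim: Ys A => //= A' Ys IH A /andP [/andP [AA' _]] /IH; exact: subset_trans.
Qed.

(** Follow a chain from the empty set to [Z]. The first element [z] added outside [s] would be
    blocked by a rule whose source avoids both [z] and [s], yet the chain member that [z] completes
    lies in [s] apart from [z] and accepts that rule. *)
Lemma maximal_interior s Z :
  maximal n nat_set nat_rules s -> inA R Z -> Z \subset X -> Z \subset to_set s.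
Proof.
move=> Hmax [Ys [pathY <- /= /andP [_ allY]]].
have : set0 \subset to_set s := sub0set _.
elim: Ys (set0 : {set 'I_n}) pathY allY => //= A' Ys IH A.
move=> /andP [/andP [AA' /cards1P [z Ez]] pathY] /andP [KA' allY] AY lastX.
have A'X : A' \subset X.
  exact: subset_trans (path_subset_last pathY) lastX.
apply: (IH A') => //.
have A'E : A' = z |: A by rewrite -Ez -[LHS](setID A' A) (setIidPr AA') setUC.
rewrite A'E subUset sub1set AY andbT inE; apply/negPn/negP => zs.
have zX : z \in X by apply: (subsetP A'X); rewrite A'E setU11.
have [] := Hmax z (ltn_ord z) zs; first by rewrite nth_nat_set.
move=> _ [/mapP [r rR ->] /= /val_inj Er zr /hasPn Hr].
have := allP KA' r rR; rewrite /accepts Er A'E setU11 /= => /set0Pn [a].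
rewrite !inE => /andP [/predU1P [->|aA] ar].
  by move: zr; rewrite mem_source ar.
have := Hr a; rewrite mem_source ar => /(_ isT) /=.
by have := subsetP AY _ aA; rewrite inE => ->.
Qed.
End Interior.

(* Puts in registers 1-7 the multiples of the array length [(n + 2) * (J + 1)],
   [J] being the number of rules: it exceeds the size of the input. *)
Definition prologue :=
  [:: ILoad 9 0; IConst 10 1; ILoad 11 10; IAdd 9 9 10; IAdd 9 9 10; IAdd 1 9 0;
      IJz 11 10; IAdd 1 1 9; ISub 11 11 10; IJz 0 6;
      IAdd 2 1 1; IAdd 3 2 1; IAdd 4 3 1; IAdd 5 4 1; IAdd 6 5 1; IAdd 7 6 1].

(** Multiplication by repeated addition, four instructions per round and one last test; with one
    round per rule this stays linear. *)
Lemma prologue_loop code Post c k g m :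
  let P := prologue ++ code in
  g 11 = c -> g 10 = 1 -> g 0 = 0 ->
  (forall g', g' 1 = g 1 + c * g 9 -> g' 0 = 0 -> halts_in P Post k (Config 10 g' m)) ->
  halts_in P Post (k + 4 * c + 1) (Config 6 g m).
Proof.
move=> P; elim: c g => [|c IH] g g11 g10 g0 H.
  apply: (halts_in_step (k := k) (c' := Config 10 g m)); last lia.
    by rewrite /step /= g11.
  by apply: H; rewrite ?addn0.
apply: (halts_in_step (k := k + 4 * c + 4) (c' := Config 7 g m)); last lia.
  by rewrite /step /= g11.
apply: (halts_in_step (k := k + 4 * c + 3)); [by [] | | lia].
apply: (halts_in_step (k := k + 4 * c + 2)); [by [] | | lia].
apply: (halts_in_step (k := k + 4 * c + 1)); last lia.
  by rewrite /step /= /upd /= g0 /=.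
apply: IH; rewrite /upd /= ?g11 ?g10 ?g0 ?subn1 // => g' E; apply: H.
by rewrite E mulSn addnA.
Qed.

Lemma prologue_correct code Post k inp :
  (forall g, (forall f, f < 8 ->
       g f = f * (nth 0 inp 0 + 2 + nth 0 inp 1 * (nth 0 inp 0 + 2))) ->
     halts_in (prologue ++ code) Post k (Config 16 g (nth 0 inp))) ->
  halts_in (prologue ++ code) Post (k + 4 * nth 0 inp 1 + 13) (init_config inp).
Proof.
set B := _ + _ * _ => H; rewrite /init_config.
(* Six instructions precede the loop and six follow it. *)
have -> : k + 4 * nth 0 inp 1 + 13 = (k + 6 + 4 * nth 0 inp 1 + 1).+1.+1.+1.+1.+1.+1 by lia.
do 6 (apply: halts_in_step (ltnSn _); first by []).
apply: prologue_loop => // g' E1 E0.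
have -> : k + 6 = k.+1.+1.+1.+1.+1.+1 by lia.
do 6 (apply: halts_in_step (ltnSn _); first by []).
apply: H => f; rewrite /upd /=.
have {}E1 : g' 1 = B by rewrite E1 /upd /= /B; lia.
by do 8 (case: f => [|f]; first by rewrite /= ?E1 ?E0; lia).
Qed.

Theorem theorem3p3 :
  exists (P : seq instr) (c : nat),
    forall (n : nat) (R : seq (rule 'I_n)) (X : {set 'I_n}),
      uniq R -> n <= lsize R ->
      exists m : nat -> nat,
        run P (c * lsize R + c) (init_config (encode R X)) = Some m /\
        is_interior R X (decode n m).
Proof.
pose W := csize interior_cmd; pose code := compile 16 interior_cmd.
(* As [n] and the number of rules are at most [lsize R], the running time is at most
   [(5 * W + 4) * lsize R + W + 14]; the constant is generous. *)
exists (prologue ++ code), (5 * W + 34) => n R X _ n_le.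
set rs := nat_rules R; set xb := nat_set X; set inp := encode R X.
have Einp : inp = n :: size rs :: map nat_of_bool xb ++ encode_rules rs := encodeE R X.
have J_le : size rs <= lsize R.
  rewrite -cost_nat_rules -/rs /cost; elim: (rs) => //= r l IH.
  by rewrite addSn ltnS (leq_trans IH) ?leq_addl.
pose Post (m : nat -> nat) := exists s, [/\ derivation n xb rs s, maximal n xb rs s &
  forall q, q < n -> (m q != 0) = (q \in s)].
suff [m [Hrun [s [Ds Hmax Hm]]]] :
    halts_in (prologue ++ code) Post ((5 * W + 34) * lsize R + (5 * W + 34)) (init_config inp).
  exists m; split=> //.
  have -> : decode n m = to_set n s by apply/setP => i; rewrite !inE Hm.
  have [HA HX] := derivation_inA Ds.
  by split=> // Z; exact: maximal_interior.
have size_xb : size xb = n by rewrite size_map size_enum_ord.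
(* The header and the membership bits take [n + 2] cells, and each rule at most [n + 2]. *)
pose B := n + 2 + size rs * (n + 2).
have size_inp : size inp <= B.
  rewrite Einp /= size_cat size_map size_xb /B.
  suff : size (encode_rules rs) <= size rs * (n + 2) by lia.
  rewrite /encode_rules /rs /nat_rules size_flatten /shape -!map_comp.
  elim: (R) => //= r l IH; rewrite mulSn size_map -cardE leq_add //.
  by rewrite addn2 !ltnS -[X in _ <= X]card_ord max_card.
apply: (@halts_in_mono _ _ (W * (3 * n + 2 * lsize R) + W + 1 + 4 * size rs + 13)); last first.
  have : W * (3 * n + 2 * lsize R) <= W * (5 * lsize R) by rewrite leq_mul2l; lia.
  by move: (W) => w; lia.
have -> : size rs = nth 0 inp 1 by rewrite Einp.
have EB : nth 0 inp 0 + 2 + nth 0 inp 1 * (nth 0 inp 0 + 2) = B by rewrite Einp.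
apply: prologue_correct; rewrite EB => g Hg.
(* The input fits into array 0, so the other seven arrays start out zero. *)
pose M f x := nth 0 inp (f * B + x).
have Hrep : rep B (fun r => g (r + 9)) M g (nth 0 inp) by [].
apply: (@wp_sound _ _ B W interior_cmd 16 (fun _ _ M' => Post (M' 0)) (3 * n + 2 * lsize R)
  _ _ _ _ 1 _ _ Hrep) => //.
- rewrite -cost_nat_rules; apply: (@interior_cmd_wp n B xb rs) => //.
  + by move=> r /mapP [r0 _ ->] /=.
  + by move=> r a /mapP [r0 _ ->] /= /mapP [b _ ->].
  + move=> r /mapP [r0 _ ->] /=; rewrite map_inj_uniq ?enum_uniq //; exact: val_inj.
  + by rewrite -Einp.
  + by rewrite /B; lia.
  + by rewrite /B; nia.
  + by move=> x xB; rewrite /M -Einp.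
  + move=> f x f0 f8 xB; rewrite /M nth_default //; nia.
move=> k' h' M' g' m' _ [_ _ Hm'] [s [Ds Hmax Hs]].
have halted : step (prologue ++ code) (Config (16 + csize interior_cmd) g' m') = None.
  by rewrite /step nth_default // size_cat size_compile.
exists m'; split; first by rewrite addn1 /run halted.
exists s; split=> // q q_n; rewrite -Hs // -Hm' //.
by rewrite /B; nia.
Qed.
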